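(* Let $n\ge 1$ and $k\ge 0$ be integers and let $f:\{-1,1\}^n\to\mathbb{Z}$, where $\{-1,1\}^n$ is endowed with the uniform measure. Suppose that all the Fourier weight of $f$ is concentrated on the first $k$ levels, i.e. $\hat f(S)=0$ for every $S\subset\{1,\ldots,n\}$ with $|S|>k$. Then for every $S\subset\{1,\ldots,n\}$ there is an integer $a(S)\in\mathbb{Z}$ such that \[ \hat f(S)=a(S)\cdot 2^{-k}. \] In particular, if $f$ is Boolean (takes values in $\{-1,1\}$), then $\mathrm{Ent}_{1/2}(f)\le 2k$.
   Context: For $S\subset\{1,\ldots,n\}$ the character $u_S:\{-1,1\}^n\to\{-1,1\}$ is $u_S(x)=\prod_{i\in S}x_i$. The characters form an orthonormal basis with respect to the uniform measure, and $\hat f(S)=\mathbb{E}[f\cdot u_S]$, so $f=\sum_S\hat f(S)u_S$ is the representation of $f$ as a multilinear polynomial. The level of $\hat f(S)$ is $|S|$. For a Boolean function $f:\{-1,1\}^n\to\{-1,1\}$ the spectral entropy is \[ \mathrm{Ent}_{1/2}(f)=\sum_{S\subset\{1,\ldots,n\}}\hat f(S)^2\log\left(\frac{1}{\hat f(S)^2}\right), \] where $\log$ is to base $2$ and zero coefficients contribute $0$. *)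

(* Defs.v *)
From HB Require Import structures.
From mathcomp Require Import all_boot all_order all_algebra.
From mathcomp Require Import all_classical all_reals all_analysis.

Set Implicit Arguments.
Unset Strict Implicit.
Unset Printing Implicit Defensive.

Import Order.TTheory GRing.Theory Num.Theory.
Local Open Scope ring_scope.

Definition pm1 : finType := seq_sub [:: (-1 : int); 1].

(* Coordinates are indexed by 'I_n, i.e. 0, ..., n - 1 instead of 1, ..., n. *)
Definition cube (n : nat) : finType := {ffun 'I_n -> pm1}.

Definition walsh (n : nat) (S : {set 'I_n}) (x : cube n) : int :=
  \prod_(i in S) val (x i).

Definition expect (R : realType) (n : nat) (g : cube n -> R) : R :=
  (\sum_(x : cube n) g x) / #|cube n|%:R.

Definition fourier (R : realType) (n : nat) (f : cube n -> R)
    (S : {set 'I_n}) : R :=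
  expect (fun x => f x * (walsh S x)%:~R).

Definition log2 (R : realType) (x : R) : R := ln x / ln 2.

(* A zero coefficient contributes 0, because of the leading factor: both
   inversion and ln are total functions. *)
Definition spectral_entropy (R : realType) (n : nat) (f : cube n -> R) : R :=
  \sum_(S : {set 'I_n}) fourier f S ^+ 2 * log2 (1 / fourier f S ^+ 2).

(* Main.v *)
Require Import Defs.
From mathcomp Require Import all_boot all_order all_algebra.
From mathcomp Require Import all_classical all_reals all_analysis.

Import Order.TTheory GRing.Theory Num.Theory.
Local Open Scope ring_scope.

(** Expanding [\prod_i (x_i + [i \notin S])] over subsets gives
    [\sum_(T \supseteq S) u_T(x)].  Each of the [n - |S|] factors [x_i + 1] is
    0 or 2, so the product is an integer multiple of [2 ^ (n - |S|)], and
    averaging against the integer-valued [f] shows that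
    [\sum_(T \supseteq S) \hat f(T)] is in [2 ^ -|S| Z].  Since [\hat f]
    vanishes above level [k], downward induction on [|S|] isolates
    [\hat f(S)].  For the entropy, a nonzero coefficient has square at least
    [2 ^ (-2k)], hence log-weight at most [2k], and the squares sum to 1 by
    Parseval. *)

Lemma pm1P (v : pm1) : val v = -1 \/ val v = 1.
Proof. by have := valP v; rewrite !inE => /orP[] /eqP ->; [left|right]. Qed.

Lemma card_cube (n : nat) : #|cube n| = (2 ^ n)%N.
Proof.
rewrite card_ffun card_ord; congr (_ ^ _)%N.
by rewrite card_seq_sub.
Qed.

Lemma sum_walsh_supset (n : nat) (S : {set 'I_n}) (x : cube n) :
  \sum_(T : {set 'I_n} | S \subset T) walsh T x =
  \prod_i (val (x i) + (i \notin S)%:R).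
Proof.
rewrite bigA_distr big_mkcond; apply: eq_bigr => T _.
(* The term of [T] is $u_T(x)$ times $\prod_{i \notin T} [i \notin S]$, and this last product is 1
   if $S \subseteq T$ and 0 otherwise. *)
rewrite (bigID (mem T)) /=.
rewrite (eq_bigr (fun i => val (x i))); last by move=> i ->.
case: ifPn => [ST|/subsetPn[i iS iT]].
  rewrite [X in _ * X]big1 ?mulr1 // => i iT.
  by rewrite (negPf iT) (contra (fintype.subsetP ST i) iT).
by rewrite [X in _ * X](bigD1 i) //= (negPf iT) iS mul0r mulr0.
Qed.

Lemma dvd_sum_walsh_supset (n : nat) (S : {set 'I_n}) (x : cube n) :
  exists c : int,
    \sum_(T : {set 'I_n} | S \subset T) walsh T x = c * 2 ^+ (n - #|S|).
Proof.
rewrite sum_walsh_supset (bigID (mem S)) /=.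
(* Outside [S] each factor is $x_i + 1 = 2 [x_i = 1]$, which supplies one power of 2. *)
exists (\prod_(i in S) val (x i) * \prod_(i in ~: S) (val (x i) == 1)%:R).
have <- : #|~: S| = (n - #|S|)%N by rewrite cardsCs finset.setCK card_ord.
rewrite -mulrA -prodr_const -big_split /=; congr (_ * _).
  by apply: eq_bigr => i ->; rewrite addr0.
apply: eq_big => [i|i iS]; first by rewrite inE.
by rewrite iS; case: (pm1P (x i)) => ->.
Qed.

(** The sum factors as $\prod_i (x_i y_i + 1)$: a factor is 2 where the points agree and 0 where
    they differ. *)
Lemma walsh_orthogonality (n : nat) (x y : cube n) :
  \sum_(S : {set 'I_n}) walsh S x * walsh S y = (x == y)%:R * 2 ^+ n.
Proof.
transitivity (\prod_i (val (x i) * val (y i) + 1)).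
  rewrite bigA_distr; apply: eq_bigr => S _.
  by rewrite /walsh -big_split big_mkcond.
have [<-|] := eqVneq x y.
  rewrite mul1r -[in RHS](card_ord n) -prodr_const.
  by apply: eq_bigr => i _; case: (pm1P (x i)) => ->.
rewrite mul0r => xy.
have [i xyi] : exists i, x i != y i.
  apply/existsP; apply: contraNT xy; rewrite negb_exists => /forallP xy.
  by apply/eqP/ffunP => i; apply/eqP; rewrite -[_ == _]negbK.
rewrite (bigD1 i) //=; move: xyi; rewrite -val_eqE /=.
by case: (pm1P (x i)) => ->; case: (pm1P (y i)) => ->; rewrite ?eqxx // => _;
  rewrite ?mulr1 ?mul1r addNr mul0r.
Qed.

Lemma parseval (R : realType) (n : nat) (f : cube n -> R) :
  \sum_(S : {set 'I_n}) fourier f S ^+ 2 = expect (fun x => f x ^+ 2).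
Proof.
set N : R := #|cube n|%:R.
have N2 : N = 2 ^+ n by rewrite /N card_cube natrX.
have N0 : N != 0 by rewrite N2 expf_neq0.
(* Expand each square as a double sum over points; summing over [S] first then leaves only the
   diagonal. *)
transitivity ((\sum_x \sum_y \sum_(S : {set 'I_n})
    (f x * f y * (walsh S x * walsh S y)%:~R)) / N ^+ 2).
  under [X in _ = X / _]eq_bigr do rewrite exchange_big /=.
  rewrite exchange_big /= mulr_suml; apply: eq_bigr => S _.
  rewrite /fourier /expect expr_div_n -/N expr2; congr (_ / _).
  rewrite mulr_suml; apply: eq_bigr => x _.
  rewrite mulr_sumr; apply: eq_bigr => y _.
  by rewrite intrM mulrACA.
rewrite /expect -/N expr2 invfM mulrA; congr (_ / _).
rewrite mulr_suml; apply: eq_bigr => x _.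
under eq_bigr do rewrite -mulr_sumr -rmorph_sum walsh_orthogonality.
rewrite (bigD1 x) //= big1 => [|y yx].
  by rewrite eqxx mul1r rmorphXn /= -N2 addr0 mulfK // expr2.
by rewrite eq_sym (negPf yx) mul0r mulr0.
Qed.

Lemma sum_fourier_supset (R : realType) (n : nat) (f : cube n -> int)
    (S : {set 'I_n}) :
  exists a : int,
    \sum_(T : {set 'I_n} | S \subset T) fourier (fun x => (f x)%:~R : R) T =
    a%:~R * 2 ^- #|S|.
Proof.
have /fin_all_exists[c cE] := dvd_sum_walsh_supset n S.
exists (\sum_x f x * c x).
rewrite /fourier /expect -mulr_suml exchange_big /= rmorph_sum !mulr_suml.
apply: eq_bigr => x _.
rewrite -mulr_sumr -rmorph_sum /= cE !rmorphM /= rmorphXn /= card_cube natrX.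
have Sn : (#|S| <= n)%N by rewrite -[leqRHS]card_ord max_card.
by rewrite -[in X in _ / X](subnK Sn) exprD invfM !mulrA mulfK.
Qed.

Lemma fourier_dyadic (R : realType) (n k : nat) (f : cube n -> int) :
  (forall S : {set 'I_n}, (k < #|S|)%N ->
     fourier (fun x => (f x)%:~R : R) S = 0) ->
  forall S : {set 'I_n}, exists a : int,
    fourier (fun x => (f x)%:~R : R) S = a%:~R * 2 ^- k.
Proof.
move=> f_low S; have [m] := ubnP (n - #|S|)%N.
elim: m => // m IH in S *; rewrite ltnS => Sm.
have [kS|Sk] := ltnP k #|S|; first by exists 0; rewrite f_low // mul0r.
have [a aE] := sum_fourier_supset R n f S.
(* The condition on [T] sits under the existential so that [b] can be chosen as a function on all
   sets, with 0 as the default. *)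
have IHS (T : {set 'I_n}) : exists b : int,
    S \proper T -> fourier (fun x => (f x)%:~R : R) T = b%:~R * 2 ^- k.
  have [ST|] := boolP (S \proper T); last by exists 0.
  have [|b bE] := IH T; last by exists b.
  (* Truncated subtraction decreases strictly here because $|S| < |T| \le n$. *)
  apply: leq_trans Sm; rewrite ltn_sub2l ?proper_card //.
  by rewrite (leq_trans (proper_card ST)) // -[leqRHS]card_ord max_card.
have /fin_all_exists[b bE] := IHS.
(* This is $2^k$ times the superset sum minus its terms with $T \ne S$; the exponent is exact since
   $|S| \le k$. *)
exists (a * 2 ^+ (k - #|S|) - \sum_(T : {set 'I_n} | S \proper T) b T).
rewrite rmorphB rmorph_sum rmorphM rmorphXn /= mulrBl mulr_suml.
rewrite -(eq_bigr _ bE).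
rewrite -[in 2 ^- k](subnK Sk) exprD invfM mulrA mulfK ?expf_neq0 //.
rewrite -aE (bigD1 S) //=; apply/eqP; rewrite eq_sym subr_eq; apply/eqP.
by congr (_ + _); apply: eq_bigl => T; rewrite finset.properEneq eq_sym andbC.
Qed.

Lemma log2_inv_sqr_le (R : realType) (k : nat) (a : int) :
  a != 0 -> log2 (1 / (a%:~R * 2 ^- k) ^+ 2 : R) <= 2 * k%:R.
Proof.
move=> a0; have ln2 : 0 < ln 2 :> R by rewrite ln_gt0 // ltr1n.
rewrite /log2 ler_pdivrMr // div1r exprMn invfM exprVn invrK.
rewrite -exprM mulnC -natrM mulr_natl -lnXn //.
(* Integrality enters here: a nonzero integer has square at least 1. *)
have a2 : 1 <= a%:~R ^+ 2 :> R.
  by rewrite -rmorphXn /= ler1z -gtz0_ge1 exprn_even_gt0.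
have a2_gt0 := lt_le_trans ltr01 a2.
rewrite ler_ln ?posrE ?mulr_gt0 ?invr_gt0 ?a2_gt0 ?exprn_gt0 //.
by rewrite ler_piMl ?exprn_ge0 // invf_le1.
Qed.

Theorem proposition3p1 (R : realType) (n k : nat) (n_ge1 : (1 <= n)%N)
    (f : cube n -> int)
    (f_low : forall S : {set 'I_n}, (k < #|S|)%N ->
       fourier (fun x => (f x)%:~R : R) S = 0) :
  (forall S : {set 'I_n}, exists a : int,
     fourier (fun x => (f x)%:~R : R) S = a%:~R * 2 ^- k)
  /\
  ((forall x : cube n, f x = -1 \/ f x = 1) ->
     spectral_entropy (fun x => (f x)%:~R : R) <= 2 * k%:R).
Proof.
have dyadic := fourier_dyadic R n k f f_low.
split=> // f_pm1.
have weight1 :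
    \sum_(S : {set 'I_n}) fourier (fun x => (f x)%:~R : R) S ^+ 2 = 1.
  rewrite parseval /expect (eq_bigr (fun=> 1)) => [|x _].
    by rewrite sumr_const divff // card_cube pnatr_eq0 expn_eq0.
  by case: (f_pm1 x) => ->; rewrite -rmorphXn.
(* Spreading $2k$ over the weights $\hat f(S)^2$ reduces the bound to one term at a time. *)
rewrite -[leRHS]mul1r -[X in X * _]weight1 mulr_suml; apply: ler_sum => S _.
have [a ->] := dyadic S.
have [->|a0] := eqVneq a 0; first by rewrite mulr0z mul0r expr0n /= !mul0r.
by rewrite ler_wpM2l ?sqr_ge0 ?log2_inv_sqr_le.
Qed.
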